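(* Let $M$ be a connected oriented smooth $4$-manifold with an $\mathrm{SU}(2)$-structure $(\omega_1,\omega_2,\omega_3)$, induced metric $g$ and torsion $1$-forms $a_1,a_2,a_3$. The self-dual Weyl curvature of $g$ is \begin{align*} W^+=&-\tfrac1{24}\Big(2g(da_1,\omega_1)-g(da_2,\omega_2)-g(da_3,\omega_3)+g(J_3a_1,a_2)-g(J_2a_1,a_3)-2g(J_1a_2,a_3)\Big)\big(2\omega_1\otimes\omega_1-\omega_2\otimes\omega_2-\omega_3\otimes\omega_3\big)\\ &-\tfrac18\Big(g(da_2,\omega_2)-g(da_3,\omega_3)+g(J_3a_1,a_2)+g(J_2a_1,a_3)\Big)\big(\omega_2\otimes\omega_2-\omega_3\otimes\omega_3\big)\\ &-\tfrac14\big(g(da_2,\omega_1)+g(J_1a_1,a_3)\big)\,\omega_1\odot\omega_2\\ &-\tfrac14\big(g(da_3,\omega_2)+g(J_2a_2,a_1)\big)\,\omega_2\odot\omega_3\\ &-\tfrac14\big(g(da_1,\omega_3)+g(J_3a_3,a_2)\big)\,\omega_3\odot\omega_1, \end{align*} where $\omega_i\odot\omega_j:=\omega_i\otimes\omega_j+\omega_j\otimes\omega_i\in S^2_0(\Lambda^2_+)$ for $i\neq j$.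
   Context: An $\mathrm{SU}(2)$-structure on a connected oriented $4$-manifold $M$ is a triple $(\omega_1,\omega_2,\omega_3)$ of $2$-forms such that near each point there is a local coframe $e^1,\dots,e^4$ with $\omega_1=e^{12}+e^{34}$, $\omega_2=e^{13}+e^{42}$, $\omega_3=e^{14}+e^{23}$ ($e^{ij}=e^i\wedge e^j$). It determines the metric $g=\sum_i e^i\otimes e^i$, the volume form $e^{1234}$, the Levi-Civita connection $\nabla$, and almost complex structures $J_i$ by $\omega_i(X,Y)=g(J_iX,Y)$. On $1$-forms, $(J_i\alpha)(X)=\alpha(J_iX)$. Inner products of $k$-forms are normalised so that $|e^{i_1\dots i_k}|=1$ (so $g(\omega_i,\omega_j)=2\delta_{ij}$). $\Lambda^2_+=\langle\omega_1,\omega_2,\omega_3\rangle$. Torsion $1$-forms: $a_1,a_2,a_3$ are the unique $1$-forms with $\nabla_X\omega_1=a_3(X)\omega_2-a_2(X)\omega_3$, $\nabla_X\omega_2=a_1(X)\omega_3-a_3(X)\omega_1$, $\nabla_X\omega_3=a_2(X)\omega_1-a_1(X)\omega_2$. The curvature tensor is viewed as a section $\mathrm{Rm}$ of $S^2(\Lambda^2)\subset\Lambda^2\otimes\Lambda^2$ with the sign convention that $\mathrm{Rm}(X,Y,X,Y)$ is the sectional curvature for orthonormal $X,Y$ (so on a product of a surface of curvature $K$, tangent to $e_1,e_2$, with a flat surface, $\mathrm{Rm}=K\,e^{12}\otimes e^{12}$). $W^+$ is the component of $\mathrm{Rm}$ in $S^2_0(\Lambda^2_+)$ (trace-free part of the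 $\Lambda^2_+\otimes\Lambda^2_+$ component). *)

(* Defs.v *)
From mathcomp Require Import all_boot all_order all_algebra.
From mathcomp Require Import all_classical all_reals all_analysis.
Import Order.TTheory GRing.Theory Num.Theory.
Import numFieldNormedType.Exports.

Set Implicit Arguments.
Unset Strict Implicit.
Unset Printing Implicit Defensive.

Local Open Scope classical_set_scope.
Local Open Scope ring_scope.

(* C^k on an open set U, by induction on k: f is C^(k+1) on U when its
   directional derivatives exist on U and are C^k there. *)
Fixpoint Ck_on (R : realType) (n : nat) (W : normedModType R) (k : nat)
    (U : set 'rV[R]_n) (f : 'rV[R]_n -> W) : Prop :=
  match k with
  | 0%N => forall x, U x -> {for x, continuous f}
  | k'.+1 => forall v, (forall x, U x -> derivable f x v) /\
                       Ck_on k' U (fun x => 'D_v f x)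
  end.

Definition smooth_on (R : realType) (n : nat) (W : normedModType R)
    (U : set 'rV[R]_n) (f : 'rV[R]_n -> W) : Prop :=
  forall k, Ck_on k U f.

(* A smooth manifold given by an atlas, not necessarily maximal, indexed by
   [chart M].  [coord c] and [coordV c] are junk outside [dom c] and
   [coord c @` dom c] respectively. *)
Record smooth_manifold (R : realType) (n : nat) := SmoothManifold {
  carrier :> topologicalType;
  chart : Type;
  dom : chart -> set carrier;
  coord : chart -> carrier -> 'rV[R]_n;
  coordV : chart -> 'rV[R]_n -> carrier;
  mfd_hausdorff : hausdorff_space carrier;
  mfd_second_countable : @second_countable carrier;
  mfd_cover : forall p, exists c, dom c p;
  dom_open : forall c, open (dom c);
  img_open : forall c, open (coord c @` dom c);
  coordK : forall c p, dom c p -> coordV c (coord c p) = p;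
  coord_continuous : forall c p, dom c p -> {for p, continuous (coord c)};
  coordV_continuous : forall c x, (coord c @` dom c) x ->
    {for x, continuous (coordV c)};
  transition_smooth : forall c c',
    smooth_on (coord c @` (dom c `&` dom c')) (coord c' \o coordV c)
}.

Section Manifold.
Variables (R : realType) (n : nat) (M : smooth_manifold R n).

Definition transition (c c' : chart M) : 'rV[R]_n -> 'rV[R]_n :=
  coord c' \o coordV c.

(* The image in R^n of the part of an open set U of M covered by the chart. *)
Definition img (U : set M) (c : chart M) : set 'rV[R]_n :=
  coord c @` (dom c `&` U).

End Manifold.

(* An oriented manifold is one given with an oriented atlas. *)
Definition oriented_atlas (R : realType) (M : smooth_manifold R 4) : Prop :=
  forall (c c' : chart M) x, img (dom c') c x ->
    0 < \det (jacobian (transition c c') x).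

Section Pointwise.
Variable R : realType.
Local Notation V := 'rV[R]_4.
Implicit Types (h : V -> V -> R) (T : V -> V -> V -> V -> R).

Definition wedge (a b : V -> R) : V -> V -> R :=
  fun u v => a u * b v - a v * b u.

Definition otimes (a b : V -> V -> R) : V -> V -> V -> V -> R :=
  fun u v z w => a u v * b z w.

Definition odot (a b : V -> V -> R) : V -> V -> V -> V -> R :=
  fun u v z w => otimes a b u v z w + otimes b a u v z w.

Definition evec (k : 'I_4) : V := delta_mx 0 k.

(* The matrix (h^{kl}) inverse to (h_{kl}). *)
Definition inv_gram h : 'M[R]_4 :=
  invmx (\matrix_(k, l) h (evec k) (evec l)).

Definition inner1 h (a b : V -> R) : R :=
  \sum_k \sum_l inv_gram h k l * (a (evec k) * b (evec l)).

(* h^{kl} h^{pq} a_{kp} b_{lq} / 2: the factor 1/2 gives e^i /\ e^j unit norm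
   for an orthonormal coframe. *)
Definition inner2 h (a b : V -> V -> R) : R :=
  2^-1 * \sum_k \sum_l \sum_p \sum_q
    inv_gram h k l * inv_gram h p q *
      (a (evec k) (evec p) * b (evec l) (evec q)).

(* The inner product of T with a (x) b in Lambda^2 (x) Lambda^2. *)
Definition inner22 h T (a b : V -> V -> R) : R :=
  inner2 h (fun u v => inner2 h (fun z w => T u v z w) b) a.

Section SelfDual.
Variables (h : V -> V -> R) (o1 o2 o3 : V -> V -> R).
Local Notation os := [:: o1; o2; o3].

(* Here Lambda^2_+ is spanned by o1, o2, o3, which are pairwise orthogonal of
   squared norm 2; an orthonormal basis is o_i / sqrt 2. *)
Definition sd_component T : V -> V -> V -> V -> R := fun u v z w =>
  \sum_(a <- os) \sum_(b <- os) 4^-1 * inner22 h T a b * otimes a b u v z w.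

Definition sd_trace T : R := \sum_(a <- os) 2^-1 * inner22 h T a a.

Definition sd_identity : V -> V -> V -> V -> R := fun u v z w =>
  \sum_(a <- os) 2^-1 * otimes a a u v z w.

Definition sd_tracefree T : V -> V -> V -> V -> R := fun u v z w =>
  T u v z w - 3^-1 * sd_trace T * sd_identity u v z w.

End SelfDual.
End Pointwise.

(* A tensor field on M (or on an open subset) is a family of tensor fields, one
   on the image of each chart, related by pullback along the transition maps;
   ['D_v (transition c c') x] is the image of the tangent vector v at x under
   the differential of the transition map. *)
Section Fields.
Variables (R : realType) (M : smooth_manifold R 4).
Local Notation V := 'rV[R]_4.

Definition field1 := chart M -> V -> V -> R.
Definition field2 := chart M -> V -> V -> V -> R.
Definition field4 := chart M -> V -> V -> V -> V -> V -> R.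
Definition endo_field := chart M -> V -> V -> V.

(* Christoffel symbols: the covariant derivative along u of the vector field
   with constant components v in the chart c, at the point x. *)
Definition christoffel := chart M -> V -> V -> V -> V.

Definition is_form1 (U : set M) (a : field1) : Prop :=
  [/\ forall c x, img U c x -> scalar (a c x),
      forall c v, smooth_on (img U c) (fun x => a c x v : R^o) &
      forall c c' x v, img (dom c' `&` U) c x ->
        a c x v = a c' (transition c c' x) ('D_v (transition c c') x)].

Definition is_form2 (U : set M) (o : field2) : Prop :=
  [/\ forall c x, img U c x ->
        (forall u, scalar (o c x u)) /\ (forall v, scalar (o c x ^~ v)),
      forall c x u, img U c x -> o c x u u = 0,
      forall c u v, smooth_on (img U c) (fun x => o c x u v : R^o) &
      forall c c' x u v, img (dom c' `&` U) c x ->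
        o c x u v = o c' (transition c c' x)
          ('D_u (transition c c') x) ('D_v (transition c c') x)].

Definition is_coframe (U : set M) (e1 e2 e3 e4 : field1) : Prop :=
  [/\ is_form1 U e1, is_form1 U e2, is_form1 U e3, is_form1 U e4 &
    forall c x, img U c x -> forall l1 l2 l3 l4 : R,
      (forall u, l1 * e1 c x u + l2 * e2 c x u + l3 * e3 c x u
                 + l4 * e4 c x u = 0) ->
      [/\ l1 = 0, l2 = 0, l3 = 0 & l4 = 0]].

Definition adapted_coframe (o1 o2 o3 : field2) (U : set M)
    (e1 e2 e3 e4 : field1) : Prop :=
  is_coframe U e1 e2 e3 e4 /\
  forall c x, img U c x -> forall u v,
    [/\ o1 c x u v = wedge (e1 c x) (e2 c x) u v + wedge (e3 c x) (e4 c x) u v,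
        o2 c x u v = wedge (e1 c x) (e3 c x) u v + wedge (e4 c x) (e2 c x) u v &
        o3 c x u v = wedge (e1 c x) (e4 c x) u v + wedge (e2 c x) (e3 c x) u v].

Definition SU2_structure (o1 o2 o3 : field2) : Prop :=
  [/\ is_form2 setT o1, is_form2 setT o2, is_form2 setT o3 &
    forall p : M, exists U : set M, [/\ open U, U p &
      exists e1 e2 e3 e4, adapted_coframe o1 o2 o3 U e1 e2 e3 e4]].

Definition induced_metric (o1 o2 o3 g : field2) : Prop :=
  forall (U : set M) e1 e2 e3 e4, open U ->
    adapted_coframe o1 o2 o3 U e1 e2 e3 e4 ->
    forall c x, img U c x -> forall u v,
      g c x u v = e1 c x u * e1 c x v + e2 c x u * e2 c x v
                + e3 c x u * e3 c x v + e4 c x u * e4 c x v.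

Definition almost_complex_of (g o : field2) (J : endo_field) : Prop :=
  forall c x, img setT c x -> forall u v, o c x u v = g c x (J c x u) v.

(* The last condition is the transformation law of Christoffel symbols under
   the change of charts. *)
Definition is_connection (G : christoffel) : Prop :=
  [/\ forall c x, img setT c x ->
        (forall u, linear (G c x u)) /\ (forall v, linear (G c x ^~ v)),
      forall c u v, smooth_on (img setT c) (fun x => G c x u v) &
      forall c c' x u v, img (dom c') c x ->
        'D_(G c x u v) (transition c c') x =
          'D_u (fun y => 'D_v (transition c c') y) x
          + G c' (transition c c' x)
              ('D_u (transition c c') x) ('D_v (transition c c') x)].

(* (nabla_X o)(u, v). *)
Definition cov_deriv2 (G : christoffel) (o : field2) (c : chart M)
    (x X u v : V) : R :=
  'D_X (fun y => o c y u v : R^o) x - o c x (G c x X u) v - o c x u (G c x X v).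

Definition levi_civita (g : field2) (G : christoffel) : Prop :=
  [/\ is_connection G,
      forall c x, img setT c x -> forall u v, G c x u v = G c x v u &
      forall c x, img setT c x -> forall X u v, cov_deriv2 G g c x X u v = 0].

Definition torsion_forms (o1 o2 o3 : field2) (G : christoffel)
    (a1 a2 a3 : field1) : Prop :=
  [/\ is_form1 setT a1, is_form1 setT a2, is_form1 setT a3 &
    forall c x, img setT c x -> forall X u v,
    [/\ cov_deriv2 G o1 c x X u v = a3 c x X * o2 c x u v - a2 c x X * o3 c x u v,
        cov_deriv2 G o2 c x X u v = a1 c x X * o3 c x u v - a3 c x X * o1 c x u v &
        cov_deriv2 G o3 c x X u v = a2 c x X * o1 c x u v - a1 c x X * o2 c x u v]].

(* d a (u, v) = u (a v) - v (a u) - a [u, v], where the fields u and v, having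
   constant components, commute. *)
Definition ext_d (a : field1) : field2 := fun c x u v =>
  'D_u (fun y => a c y v : R^o) x - 'D_v (fun y => a c y u : R^o) x.

(* R(u, v) w = nabla_u nabla_v w - nabla_v nabla_u w for fields u, v, w with
   constant components. *)
Definition curvature (G : christoffel) (c : chart M) (x u v w : V) : V :=
  'D_u (fun y => G c y v w) x - 'D_v (fun y => G c y u w) x
  + G c x u (G c x v w) - G c x v (G c x u w).

(* The order of the last two arguments makes [riemann g G c x u v u v] the
   sectional curvature for orthonormal u, v. *)
Definition riemann (g : field2) (G : christoffel) : field4 :=
  fun c x u v z w => g c x (curvature G c x u v w) z.

Definition weyl_plus (o1 o2 o3 g : field2) (G : christoffel) : field4 :=
  fun c x =>
    sd_tracefree (g c x) (o1 c x) (o2 c x) (o3 c x)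
      (sd_component (g c x) (o1 c x) (o2 c x) (o3 c x) (riemann g G c x)).

End Fields.

(* Main.v *)
Require Import Defs.
From mathcomp Require Import all_boot all_order all_algebra.
From mathcomp Require Import all_classical all_reals all_analysis.
From mathcomp Require Import ring lra.

Set Implicit Arguments.
Unset Strict Implicit.
Unset Printing Implicit Defensive.

Import Order.TTheory GRing.Theory Num.Theory.
Import numFieldNormedType.Exports.
Local Open Scope classical_set_scope.
Local Open Scope ring_scope.

(** The forms w_1, w_2, w_3 frame the bundle of self-dual 2-forms, and in this
    frame the connection induced by nabla is the so(3)-valued 1-form with
    entries a_1, a_2, a_3.  Its curvature therefore has the entries
    F_i = da_i + a_j /\ a_k, for (i, j, k) a cyclic permutation of (1, 2, 3).
    On the other hand this curvature is the action of Rm(u, v), an element of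
    so(4), on self-dual forms.  The anti-self-dual part of Rm(u, v) acts
    trivially, and the self-dual part, with coefficients c_i in the w_i, acts
    as - 2 times the cross product with c, which gives c_i = - F_i(u, v) / 2.
    So the inner product of Rm(u, v) with w_i is - F_i(u, v), and the component
    of Rm in the square of the space of self-dual forms has the coefficient
    - g(F_j, w_i) / 4 on w_i (x) w_j.

    Removing the trace gives W+.  The inner product of a_j /\ a_k with w_i is
    - g(J_i a_j, a_k), which turns the quadratic part of F into the terms with
    the J_i.  Off the diagonal, g(F_j, w_i) and g(F_i, w_j) agree because Rm is
    symmetric under exchange of pairs, so that either one can be used.

    The comparison rests on the Ricci identity ([ricci_identity]), which
    [curvature_rotation] specializes to the w_i; the latter is read off in a
    frame by [rotation_component1] and [rotation_component23].  The Ricci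
    identity applied to g gives the skew-symmetry of Rm.  It needs Schwarz'
    theorem ([derive_comm]) for directional derivatives, and Leibniz' rule for
    tensors contracted with vector fields ([is_derive_contract]).  Everything
    takes place in one chart, near one point: an adapted coframe there makes g
    a sum of squares, and the dual frame turns the inner products, defined by
    the inverse Gram matrix, into sums over an orthonormal basis. *)

(** * Linear forms on row vectors *)

Section ScalarForms.
Variables (R : realType) (n : nat).

Implicit Types (l : 'rV[R]_n -> R) (a b : 'rV[R]_n).

Lemma scalar_zero l : scalar l -> l 0 = 0.
Proof. by move=> sl; have := sl (-1) 0 0; rewrite scaler0 addr0 mulN1r addNr. Qed.

Lemma scalarD l a b : scalar l -> l (a + b) = l a + l b.
Proof. by move=> sl; have := sl 1 a b; rewrite scale1r mul1r. Qed.

Lemma scalarB l a b : scalar l -> l (a - b) = l a - l b.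
Proof.
move=> sl; rewrite [a - b]addrC [l a - l b]addrC -mulN1r -scaleN1r; exact: sl.
Qed.

Lemma scalarN l a : scalar l -> l (- a) = - l a.
Proof. by move=> sl; rewrite -[- a]add0r scalarB // scalar_zero // sub0r. Qed.

Lemma scalar_sum l (I : Type) (s : seq I) (c : I -> R) (w : I -> 'rV[R]_n) :
  scalar l -> l (\sum_(i <- s) c i *: w i) = \sum_(i <- s) c i * l (w i).
Proof.
move=> sl.
by elim/big_rec2: _ => [|i y z _ <-]; [exact: scalar_zero|rewrite sl].
Qed.

Definition bilinear_form (b : 'rV[R]_n -> 'rV[R]_n -> R) :=
  (forall u, scalar (b u)) /\ (forall v, scalar (b ^~ v)).

End ScalarForms.

(** * Directional derivatives *)

Section Calculus.
Variables (R : realType) (V : normedModType R).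

Lemma is_derive_line (f : V -> R^o) (u y : V) (s : R) :
  derivable f (s *: u + y) u ->
  is_derive s (1 : R^o) (fun t : R^o => f (t *: u + y)) ('D_u f (s *: u + y)).
Proof.
move=> df.
have E : (fun h : R => h^-1 *: (((fun t : R^o => f (t *: u + y)) \o shift s)
            (h *: (1 : R^o)) - f (s *: u + y))) =
         (fun h => h^-1 *: ((f \o shift (s *: u + y)) (h *: u) - f (s *: u + y))).
  apply/funext => h /=; congr (_ *: (f _ - _)).
  by rewrite [h *: _]mulr1 scalerDl addrA.
by split; rewrite /derivable /derive E.
Qed.

Lemma is_derive_translate (f : V -> R^o) (u w y : V) :
  derivable f (w + y) u ->
  is_derive y u (fun z => f (w + z)) ('D_u f (w + y)).
Proof.
move=> df.
have E : (fun h : R => h^-1 *: (((fun z => f (w + z)) \o shift y) (h *: u)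
            - f (w + y))) =
         (fun h => h^-1 *: ((f \o shift (w + y)) (h *: u) - f (w + y))).
  by apply/funext => h /=; rewrite addrCA.
by split; rewrite /derivable /derive E.
Qed.

Lemma mvt_line (f : V -> R^o) (u y : V) (h : R) : 0 < h ->
  (forall s, 0 <= s <= h -> derivable f (s *: u + y) u) ->
  exists2 s, 0 < s < h & f (h *: u + y) - f y = h * 'D_u f (s *: u + y).
Proof.
move=> h0 df.
have dl s : s \in `[0, h] -> is_derive s (1 : R^o)
    (fun t : R^o => f (t *: u + y)) ('D_u f (s *: u + y)).
  by rewrite in_itv /= => /df; exact: is_derive_line.
have dg := @MVT R (fun t : R => f (t *: u + y) : R)
  (fun s : R => 'D_u f (s *: u + y) : R) 0 h h0.
have cg : {within `[0, h], continuous (fun t : R => f (t *: u + y) : R)}.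
  apply: derivable_within_continuous => s /dl; by case.
have di s : s \in `]0, h[ -> is_derive s (1 : R^o)
    (fun t : R^o => f (t *: u + y)) ('D_u f (s *: u + y)).
  move=> sh; apply: dl; move: sh; rewrite !in_itv /= => /andP[s0 sh].
  by rewrite !ltW.
have [s sh E] := dg di cg.
exists s; first by move: sh; rewrite in_itv.
by move: E; rewrite scale0r add0r subr0 mulrC.
Qed.

(** The double difference over a parallelogram with sides h u and h v does not
    depend on the order of u and v, while applying the mean value theorem first
    along u and then along v expresses it by the mixed derivative taken in that
    order.  N serves to keep the mean value point close to x. *)
Lemma double_difference (f : V -> R^o) (u v x : V) (N : set V) :
  nbhs x N ->
  (forall y, N y -> derivable f y u) ->
  (forall y, N y -> derivable ('D_u f) y v) ->
  \forall h \near 0^'+, exists2 z, N z &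
    f (h *: u + (h *: v + x)) - f (h *: v + x) - f (h *: u + x) + f x =
    h * h * 'D_v ('D_u f) z.
Proof.
move=> /nbhs_ballP[r /= r0 rN] du dvu.
near=> h.
have h0 : 0 < h by [].
have h0' : 0 <= h by exact: ltW.
have box s t : 0 <= s <= h -> 0 <= t <= h -> N (s *: u + (t *: v + x)).
  move=> /andP[s0 sh] /andP[t0 th]; apply: rN.
  rewrite -ball_normE /= distrC addrA addrK.
  apply: (@le_lt_trans _ _ (h * (`|u| + `|v|))).
    rewrite (le_trans (ler_normD _ _)) // mulrDr !normrZ !ger0_norm //.
    by rewrite lerD // ler_wpM2r.
  apply: (@le_lt_trans _ _ (h * (`|u| + `|v| + 1))).
    by rewrite ler_wpM2l ?ltW // ltrDl.
  rewrite -ltr_pdivlMr ?ltr_wpDl ?addr_ge0 //.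
  near: h; apply: nbhs_right_lt.
  by rewrite divr_gt0 // ltr_wpDl ?addr_ge0.
have h00 : 0 <= (0 : R) <= h by apply/andP; split.
have hh : 0 <= h <= h by apply/andP; split.
(* The double difference is the increment of k along u. *)
pose k := fun y => f (h *: v + y) - f y.
have dk s : 0 <= s <= h -> is_derive (s *: u + x) u k
    ('D_u f (h *: v + (s *: u + x)) - 'D_u f (s *: u + x)).
  move=> sh; apply: is_deriveB.
    by apply: is_derive_translate; apply: du; rewrite addrCA; apply: box.
  by apply/derivableP/du; rewrite -[x in _ + x]add0r -(scale0r v); apply: box.
have [s sh Es] : exists2 s, 0 < s < h &
    k (h *: u + x) - k x = h * 'D_u k (s *: u + x).
  by apply: (mvt_line (f := k) (u := u) h0) => s /dk [].
have {}sh : 0 <= s <= h by case/andP: sh => s0 sh; rewrite !ltW.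
have [t th Et] : exists2 t, 0 < t < h &
    'D_u f (h *: v + (s *: u + x)) - 'D_u f (s *: u + x) =
    h * 'D_v ('D_u f) (t *: v + (s *: u + x)).
  apply: (mvt_line (f := 'D_u f) (u := v) h0) => t th; apply: dvu.
  by rewrite addrCA; apply: box.
have {}th : 0 <= t <= h by case/andP: th => t0 th; rewrite !ltW.
exists (t *: v + (s *: u + x)); first by rewrite addrCA; apply: box.
have [_ Dk] := dk s sh; move: Es; rewrite Dk Et mulrA => <-.
rewrite /k [h *: v + (h *: u + x)]addrCA.
have regroup (a b c d : R) : a - b - c + d = a - c - (b - d) by ring.
exact: regroup.
Unshelve. all: by end_near. Qed.

Lemma ler_dist_half (a b d e : R) :
  `|a - d| < e / 2 -> `|b - d| < e / 2 -> `|a - b| <= e.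
Proof.
move=> ad bd; rewrite [e]splitr (le_trans (ler_distD d _ _)) // ltW // ltrD //.
by rewrite distrC.
Qed.

(** Schwarz' theorem: both mixed derivatives approximate the same double
    difference, divided by h ^ 2, and are continuous at x. *)
Lemma derive_comm (f : V -> R^o) (u v x : V) (U : set V) :
  open U -> U x ->
  (forall y, U y -> derivable f y u /\ derivable f y v) ->
  (forall y, U y -> derivable ('D_u f) y v /\ derivable ('D_v f) y u) ->
  {for x, continuous ('D_v ('D_u f))} -> {for x, continuous ('D_u ('D_v f))} ->
  'D_u ('D_v f) x = 'D_v ('D_u f) x.
Proof.
move=> oU Ux df ddf cvu cuv.
apply/eqP; rewrite -subr_eq0 -normr_le0; apply/ler_addgt0Pl => e e0.
rewrite addr0.
have e20 : 0 < e / 2 by rewrite divr_gt0.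
pose N := [set y | U y /\ `|'D_v ('D_u f) x - 'D_v ('D_u f) y| < e / 2 /\
                   `|'D_u ('D_v f) x - 'D_u ('D_v f) y| < e / 2].
have nN : nbhs x N.
  apply: filterI; first exact: open_nbhs_nbhs.
  apply: filterI.
    by move/cvgrPdist_lt : cvu; apply.
  by move/cvgrPdist_lt : cuv; apply.
have D1 : \forall h \near 0^'+, exists2 z, N z &
    f (h *: u + (h *: v + x)) - f (h *: v + x) - f (h *: u + x) + f x =
    h * h * 'D_v ('D_u f) z.
  apply: double_difference nN _ _ => y [Uy _].
    exact: (df y Uy).1.
  exact: (ddf y Uy).1.
have D2 : \forall h \near 0^'+, exists2 z, N z &
    f (h *: v + (h *: u + x)) - f (h *: u + x) - f (h *: v + x) + f x =
    h * h * 'D_u ('D_v f) z.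
  apply: double_difference nN _ _ => y [Uy _].
    exact: (df y Uy).2.
  exact: (ddf y Uy).2.
have [h [h0 [[z [_ [Nz _]] Ez] [z' [_ [_ Nz']] Ez']]]] : exists h : R, 0 < h /\
   ((exists2 z, N z &
    f (h *: u + (h *: v + x)) - f (h *: v + x) - f (h *: u + x) + f x =
    h * h * 'D_v ('D_u f) z) /\
   (exists2 z, N z &
    f (h *: v + (h *: u + x)) - f (h *: u + x) - f (h *: v + x) + f x =
    h * h * 'D_u ('D_v f) z)).
  have [h [h0 H]] := filter_ex (filterI (nbhs_right_gt 0) (filterI D1 D2)).
  by exists h.
have E : 'D_u ('D_v f) z' = 'D_v ('D_u f) z.
  apply: (@mulfI _ (h * h)); first by rewrite mulf_neq0 ?gt_eqF.
  apply: etrans (esym Ez') _; apply: etrans _ Ez.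
  rewrite [h *: v + (h *: u + x)]addrCA.
  have regroup (a b c d : R) : a - b - c + d = a - c - b + d by ring.
  exact: regroup.
by apply: ler_dist_half Nz' _; rewrite E.
Qed.

(** Leibniz' rule for a field of linear forms contracted with a vector field:
    in coordinates the contraction is a sum of products. *)
Lemma is_derive_contract n (l : 'rV[R]_n -> 'rV[R]_n -> R^o)
    (Z : 'rV[R]_n -> 'rV[R]_n) (O : set 'rV[R]_n) (x u : 'rV[R]_n) :
  open O -> O x -> (forall y, O y -> scalar (l y)) ->
  (forall w, derivable (l ^~ w) x u) -> derivable Z x u ->
  is_derive x u (fun y => l y (Z y) : R^o)
    (l x ('D_u Z x) + 'D_u (l ^~ (Z x)) x).
Proof.
move=> oO Ox sl dl dZ.
have nO : nbhs x O by exact: open_nbhs_nbhs.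
have main (Y : 'rV[R]_n -> 'rV[R]_n) : derivable Y x u ->
  is_derive x u (fun y => l y (Y y) : R^o)
    (l x ('D_u Y x) + \sum_k Y x 0 k * 'D_u (l ^~ (delta_mx 0 k)) x).
  move=> dY.
  have dc k : derivable (fun y => Y y 0 k : R^o) x u.
    by move/derivable_mxP: dY; apply.
  have E : {near x, (\sum_k ((fun y => Y y 0 k : R^o) * (l ^~ (delta_mx 0 k)))) =1
                    (fun y => l y (Y y))}.
    near=> y.
    rewrite fct_sumE [in RHS](row_sum_delta (Y y)) scalar_sum //.
    by apply: sl; near: y.
  apply: near_eq_is_derive E _.
  have H k : is_derive x u ((fun y => Y y 0 k : R^o) * (l ^~ (delta_mx 0 k)))
      (Y x 0 k *: 'D_u (l ^~ (delta_mx 0 k)) x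
       + l x (delta_mx 0 k) *: 'D_u (fun y => Y y 0 k : R^o) x).
    by apply: is_deriveM; apply/derivableP.
  apply: is_derive_eq (is_derive_sum H) _.
  rewrite big_split addrC /=; congr (_ + _).
  rewrite [in RHS](row_sum_delta ('D_u Y x)) (scalar_sum _ _ _ (sl x Ox)).
  apply: eq_bigr => k _; rewrite derive_mx // mxE; exact: mulrC.
(* For a constant vector field the rule identifies the remaining sum. *)
have [_] := main (cst (Z x)) (derivable_cst _ _ _).
rewrite derive_cst => D0.
apply: is_derive_eq (main Z dZ) _.
rewrite D0; congr (_ + _); rewrite -[LHS]add0r; congr (_ + _).
by rewrite scalar_zero //; exact: sl.
Unshelve. all: by end_near. Qed.

End Calculus.

(** * Smooth functions *)

Section Smooth.
Variables (R : realType) (n : nat).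
Implicit Types (f g : 'rV[R]_n -> R^o) (U : set 'rV[R]_n).

Lemma smooth_derivable (W : normedModType R) U (f : 'rV[R]_n -> W) y v :
  smooth_on U f -> U y -> derivable f y v.
Proof. by move=> sf Uy; apply: (sf 1%N v).1. Qed.

Lemma smooth_derive (W : normedModType R) U (f : 'rV[R]_n -> W) v :
  smooth_on U f -> smooth_on U ('D_v f).
Proof. by move=> sf k; apply: (sf k.+1 v).2. Qed.

Lemma smooth_on_sub (W : normedModType R) U U' (f : 'rV[R]_n -> W) :
  U `<=` U' -> smooth_on U' f -> smooth_on U f.
Proof.
move=> UU' sf k; move: f sf; elim: k => [|k IH] f sf.
  by move=> x /UU' Ux; apply: sf 0%N x Ux.
move=> v; split; last by apply: IH; apply: smooth_derive.
by move=> x /UU'; apply: smooth_derivable.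
Qed.

Lemma Ck_on_ext U f g k : open U -> (forall y, U y -> f y = g y) ->
  Ck_on k U f -> Ck_on k U g.
Proof.
move=> oU; elim: k f g => [|k IH] f g fg.
  move=> cf y Uy; have nfg : {near y, f =1 g}.
    by apply: filterS (open_nbhs_nbhs (conj oU Uy)) => z /fg.
  have fgy : f @ y --> g y by rewrite -fg //; apply: cf.
  apply: cvg_trans fgy; exact: near_eq_cvg nfg.
have nfg y : U y -> {near y, f =1 g}.
  by move=> Uy; apply: filterS (open_nbhs_nbhs (conj oU Uy)) => z /fg.
move=> cf v; have [df cdf] := cf v; split=> [y Uy|].
  exact: near_eq_derivable (nfg y Uy) (df y Uy).
by apply: IH cdf => y Uy; apply: near_eq_derive; exact: nfg.
Qed.

Lemma Ck_onD U f g k : open U -> Ck_on k U f -> Ck_on k U g ->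
  Ck_on k U (f + g).
Proof.
move=> oU; elim: k f g => [|k IH] f g cf cg.
  by move=> y Uy; apply: continuousD; [exact: cf|exact: cg].
move=> v; have [[df cdf] [dg cdg]] := (cf v, cg v).
split=> [y Uy|]; first by apply: derivableD; [exact: df|exact: dg].
apply: (@Ck_on_ext U ('D_v f + 'D_v g)) => // [y Uy|]; last exact: IH.
by rewrite deriveD; [|exact: df|exact: dg].
Qed.

Lemma smoothD U f g : open U -> smooth_on U f -> smooth_on U g ->
  smooth_on U (f + g).
Proof. by move=> oU sf sg k; apply: Ck_onD. Qed.

(** The induction is on the order of differentiability alone, for all smooth f
    and g at once: [Ck_on k.+1] does not visibly contain [Ck_on k], so that the
    factors f and g in the derivative of f * g must stay smooth. *)
Lemma smoothM U f g : open U -> smooth_on U f -> smooth_on U g ->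
  smooth_on U (f * g : 'rV[R]_n -> R^o).
Proof.
move=> oU sf sg k; elim: k f g sf sg => [|k IH] f g sf sg.
  by move=> y Uy; apply: continuousM; [exact: sf 0%N y Uy|exact: sg 0%N y Uy].
move=> v; split=> [y Uy|].
  apply: derivableM; [exact: smooth_derivable sf Uy|].
  exact: smooth_derivable sg Uy.
apply: (@Ck_on_ext U (f * 'D_v g + g * 'D_v f)) => // [y Uy|].
  rewrite deriveM; [by []|exact: smooth_derivable sf Uy|].
  exact: smooth_derivable sg Uy.
by apply: Ck_onD => //; apply: IH => //; apply: smooth_derive.
Qed.

Lemma smooth_derive_comm U f u v x : open U -> U x -> smooth_on U f ->
  'D_u ('D_v f) x = 'D_v ('D_u f) x.
Proof.
move=> oU Ux sf; apply: (derive_comm oU Ux).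
- by move=> y Uy; split; exact: smooth_derivable sf Uy.
- move=> y Uy; split; apply: smooth_derivable Uy; exact: smooth_derive.
- by apply: (smooth_derive v (smooth_derive u sf)) 0%N x Ux.
- by apply: (smooth_derive u (smooth_derive v sf)) 0%N x Ux.
Qed.

End Smooth.

(** * The Ricci identity *)

Section Ricci.
Variables (R : realType) (M : smooth_manifold R 4).
Local Notation V := 'rV[R]_4.
Variables (G : christoffel M) (o : field2 M) (c : chart M) (O : set V) (x : V).
Hypotheses (oO : open O) (Ox : O x).
Hypothesis o_bilinear : forall y, O y -> bilinear_form (o c y).
Hypothesis o_smooth : forall u v, smooth_on O (fun y => o c y u v : R^o).
Hypothesis G_smooth : forall u v, smooth_on O (fun y => G c y u v).

Lemma is_derive_cov_deriv2 u v p q :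
  is_derive x u (fun y => cov_deriv2 G o c y v p q : R^o)
    ('D_u ('D_v (fun y => o c y p q : R^o)) x
     - (o c x ('D_u (fun y => G c y v p) x) q
        + 'D_u (fun y => o c y (G c x v p) q : R^o) x)
     - (o c x p ('D_u (fun y => G c y v q) x)
        + 'D_u (fun y => o c y p (G c x v q) : R^o) x)).
Proof.
apply: is_deriveB; first apply: is_deriveB.
- apply/derivableP; apply: smooth_derivable Ox; exact: smooth_derive.
- apply: (@is_derive_contract _ _ (fun y w => o c y w q) _ O) => //.
  + by move=> y Oy; apply: (o_bilinear Oy).2.
  + by move=> w; apply: smooth_derivable Ox.
  + by apply: smooth_derivable Ox.
- apply: (@is_derive_contract _ _ (fun y w => o c y p w) _ O) => //.
  + by move=> y Oy; apply: (o_bilinear Oy).1.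
  + by move=> w; apply: smooth_derivable Ox.
  + by apply: smooth_derivable Ox.
Qed.

(** The second derivatives of the components of o cancel; what they leave are
    the derivatives of the Christoffel symbols, which make up the curvature.
    The last four terms appear because p and q have constant components, so
    that their covariant derivatives do not vanish. *)
Lemma ricci_identity u v p q :
  'D_u (fun y => cov_deriv2 G o c y v p q : R^o) x
  - 'D_v (fun y => cov_deriv2 G o c y u p q : R^o) x =
  - o c x (curvature G c x u v p) q - o c x p (curvature G c x u v q)
  - cov_deriv2 G o c x u (G c x v p) q - cov_deriv2 G o c x u p (G c x v q)
  + cov_deriv2 G o c x v (G c x u p) q + cov_deriv2 G o c x v p (G c x u q).
Proof.
have [sr sl] := o_bilinear Ox.
have [_ ->] := is_derive_cov_deriv2 u v p q.
have [_ ->] := is_derive_cov_deriv2 v u p q.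
rewrite (smooth_derive_comm u v oO Ox (o_smooth p q)) /cov_deriv2 /curvature.
rewrite (@scalarB _ _ (o c x ^~ q)) // (@scalarD _ _ (o c x ^~ q)) //.
rewrite (@scalarB _ _ (o c x ^~ q)) // (@scalarB _ _ (o c x p)) //.
rewrite (@scalarD _ _ (o c x p)) // (@scalarB _ _ (o c x p)) //.
ring.
Qed.

End Ricci.

(** * Curvature of the bundle of self-dual forms *)

Section Rotation.
Variables (R : realType) (M : smooth_manifold R 4).
Local Notation V := 'rV[R]_4.
Variables (G : christoffel M) (o1 o2 o3 : field2 M) (a1 a2 a3 : field1 M).
Variables (c : chart M) (O : set V) (x : V).
Hypotheses (oO : open O) (Ox : O x).
Hypothesis o1_bilinear : forall y, O y -> bilinear_form (o1 c y).
Hypothesis o1_smooth : forall u v, smooth_on O (fun y => o1 c y u v : R^o).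
Hypothesis o2_smooth : forall u v, smooth_on O (fun y => o2 c y u v : R^o).
Hypothesis o3_smooth : forall u v, smooth_on O (fun y => o3 c y u v : R^o).
Hypothesis a2_smooth : forall u, smooth_on O (fun y => a2 c y u : R^o).
Hypothesis a3_smooth : forall u, smooth_on O (fun y => a3 c y u : R^o).
Hypothesis G_smooth : forall u v, smooth_on O (fun y => G c y u v).
Hypothesis torsion : forall y X p q, O y ->
  [/\ cov_deriv2 G o1 c y X p q = a3 c y X * o2 c y p q - a2 c y X * o3 c y p q,
      cov_deriv2 G o2 c y X p q = a1 c y X * o3 c y p q - a3 c y X * o1 c y p q &
      cov_deriv2 G o3 c y X p q = a2 c y X * o1 c y p q - a1 c y X * o2 c y p q].

Lemma derive_torsion u v p q :
  'D_u (fun y => cov_deriv2 G o1 c y v p q : R^o) x =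
  a3 c x v * 'D_u (fun y => o2 c y p q : R^o) x
  + o2 c x p q * 'D_u (fun y => a3 c y v : R^o) x
  - (a2 c x v * 'D_u (fun y => o3 c y p q : R^o) x
  + o3 c x p q * 'D_u (fun y => a2 c y v : R^o) x).
Proof.
have E : \near x, cov_deriv2 G o1 c x v p q =
  ((fun y => a3 c y v : R^o) * (fun y => o2 c y p q : R^o)
   - (fun y => a2 c y v : R^o) * (fun y => o3 c y p q : R^o)) x.
  apply: filterS (open_nbhs_nbhs (conj oO Ox)) => y Oy.
  by have [-> _ _] := torsion v p q Oy.
rewrite (near_eq_derive _ E).
have da w : derivable (fun y => a2 c y w : R^o) x u.
  by apply: smooth_derivable Ox.
have db w : derivable (fun y => a3 c y w : R^o) x u.
  by apply: smooth_derivable Ox.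
have d2 : derivable (fun y => o2 c y p q : R^o) x u.
  by apply: smooth_derivable Ox.
have d3 : derivable (fun y => o3 c y p q : R^o) x u.
  by apply: smooth_derivable Ox.
by rewrite (deriveB (derivableM (db v) d2) (derivableM (da v) d3))
  (deriveM (db v) d2) (deriveM (da v) d3).
Qed.

Lemma derive_cov_deriv2E (o : field2 M) u p q :
  'D_u (fun y => o c y p q : R^o) x = cov_deriv2 G o c x u p q
    + o c x p (G c x u q) + o c x (G c x u p) q.
Proof. by rewrite /cov_deriv2 !subrK. Qed.

(** The Ricci identity for o1, whose covariant derivative is a combination of
    o2 and o3: this is the first row of dA - A /\ A, where A is the connection
    matrix in the frame (o1, o2, o3).  The other rows follow by cyclic
    permutation. *)
Lemma curvature_rotation u v p q :
  - o1 c x (curvature G c x u v p) q - o1 c x p (curvature G c x u v q) =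
  (ext_d a3 c x u v + wedge (a1 c x) (a2 c x) u v) * o2 c x p q
  - (ext_d a2 c x u v + wedge (a3 c x) (a1 c x) u v) * o3 c x p q.
Proof.
have := ricci_identity oO Ox o1_bilinear o1_smooth G_smooth u v p q.
rewrite !derive_torsion !derive_cov_deriv2E.
have C1 X a b : cov_deriv2 G o1 c x X a b =
  a3 c x X * o2 c x a b - a2 c x X * o3 c x a b by have [] := torsion X a b Ox.
have C2 X a b : cov_deriv2 G o2 c x X a b =
  a1 c x X * o3 c x a b - a3 c x X * o1 c x a b by have [] := torsion X a b Ox.
have C3 X a b : cov_deriv2 G o3 c x X a b =
  a2 c x X * o1 c x a b - a1 c x X * o2 c x a b by have [] := torsion X a b Ox.
rewrite !C1 !C2 !C3 /ext_d /wedge.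
move: (o1 c x (curvature _ _ _ _ _ _) _) (o1 c x _ (curvature _ _ _ _ _ _)).
move=> s t.
have solve (L y k1 k2 k3 k4 : R) :
  L = y - k1 - k2 + k3 + k4 -> y = L + k1 + k2 - k3 - k4 by move=> ->; ring.
by move/solve => ->; ring.
Qed.

End Rotation.

(** * Symmetries of the curvature tensor *)

Lemma pair_symmetry (R : realType) (V : Type) (T : V -> V -> V -> V -> R) :
  (forall u v z w, T u v z w = - T v u z w) ->
  (forall u v z w, T u v z w = - T u v w z) ->
  (forall u v z w, T u v z w + T v w z u + T w u z v = 0) ->
  forall u v z w, T u v z w = T z w u v.
Proof.
move=> s12 s34 b u v z w.
(* One Bianchi identity for each vector kept fixed in the third slot. *)
have bz := b u v z w; have bw := b u v w z.
have bu := b v z u w; have bv := b u z v w.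
have e1 : T w u z v = T u w v z by rewrite s12 s34 opprK.
have e2 : T u v w z = - T u v z w by exact: s34.
have e3 : T v z w u = - T v z u w by exact: s34.
have e4 : T z u w v = - T z u v w by exact: s34.
have e5 : T w v u z = T v w z u by rewrite s12 s34 opprK.
have e6 : T u z v w = - T z u v w by exact: s12.
have e7 : T z w v u = - T z w u v by exact: s34.
have e8 : T w u v z = - T u w v z by exact: s12.
lra.
Qed.

Section Symmetries.
Variables (R : realType) (M : smooth_manifold R 4).
Local Notation V := 'rV[R]_4.
Variables (G : christoffel M) (g : field2 M) (c : chart M) (O : set V) (x : V).
Hypotheses (oO : open O) (Ox : O x).

Lemma curvature_skew u v w : curvature G c x u v w = - curvature G c x v u w.
Proof.
have flip (k l m n : V) : k - l + m - n = - (l - k + n - m).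
  by apply/rowP => i; rewrite !mxE; ring.
exact: flip.
Qed.

Lemma curvature_bianchi u v w :
  (forall y, O y -> forall a b, G c y a b = G c y b a) ->
  curvature G c x u v w + curvature G c x v w u + curvature G c x w u v = 0.
Proof.
move=> symG; have nO := open_nbhs_nbhs (conj oO Ox).
have E a b d : 'D_a (fun y => G c y b d) x = 'D_a (fun y => G c y d b) x.
  by apply: near_eq_derive; apply: filterS nO => y Oy; exact: symG.
rewrite /curvature (E u w v) (E v w u) (E w v u).
rewrite (symG x Ox w v) (symG x Ox w u) (symG x Ox v u).
have cancel (p q r k l m : V) :
  p - q + k - l + (q - r + l - m) + (r - p + m - k) = 0.
  by apply/rowP => i; rewrite !mxE; ring.
exact: cancel.
Qed.

Hypothesis g_bilinear : forall y, O y -> bilinear_form (g c y).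
Hypothesis g_smooth : forall u v, smooth_on O (fun y => g c y u v : R^o).
Hypothesis G_smooth : forall u v, smooth_on O (fun y => G c y u v).
Hypothesis g_sym : forall u v, g c x u v = g c x v u.
Hypothesis g_parallel :
  forall y X u v, O y -> cov_deriv2 G g c y X u v = 0.

(** The Ricci identity for the parallel tensor g. *)
Lemma riemann_skew u v z w :
  riemann g G c x u v z w = - riemann g G c x u v w z.
Proof.
have D0 a b : 'D_a (fun y => cov_deriv2 G g c y b z w : R^o) x = 0.
  rewrite -[RHS](derive_cst (0 : R^o) x a); apply: near_eq_derive.
  by apply: filterS (open_nbhs_nbhs (conj oO Ox)) => y Oy; exact: g_parallel.
have := ricci_identity oO Ox g_bilinear g_smooth G_smooth u v z w.
rewrite !D0 !g_parallel // !subr0 !addr0 /riemann => /esym/eqP.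
by rewrite subr_eq0 g_sym => /eqP ->.
Qed.

End Symmetries.

(** * Inner products of 2-forms and the trace-free self-dual part *)

Section InnerProduct.
Variables (R : realType) (h : 'rV[R]_4 -> 'rV[R]_4 -> R).
Implicit Types a b : 'rV[R]_4 -> 'rV[R]_4 -> R.

Lemma inner2Dl a a' b :
  inner2 h (fun u v => a u v + a' u v) b = inner2 h a b + inner2 h a' b.
Proof.
rewrite /inner2 -mulrDr; congr (_ * _).
do 4! [rewrite -big_split /=; apply: eq_bigr => ? _].
by rewrite mulrDl mulrDr.
Qed.

Lemma inner2Zl k a b :
  inner2 h (fun u v => k * a u v) b = k * inner2 h a b.
Proof.
rewrite /inner2 mulrCA; congr (_ * _).
do 4! [rewrite mulr_sumr; apply: eq_bigr => ? _].
by ring.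
Qed.

Lemma inner2Dr a b b' :
  inner2 h a (fun u v => b u v + b' u v) = inner2 h a b + inner2 h a b'.
Proof.
rewrite /inner2 -mulrDr; congr (_ * _).
do 4! [rewrite -big_split /=; apply: eq_bigr => ? _].
by rewrite !mulrDr.
Qed.

Lemma inner2_suml (I : Type) (s : seq I) (F : I -> 'rV[R]_4 -> 'rV[R]_4 -> R) b :
  inner2 h (fun u v => \sum_(i <- s) F i u v) b = \sum_(i <- s) inner2 h (F i) b.
Proof.
elim: s => [|i s IH].
  rewrite big_nil -[RHS](mul0r (inner2 h b b)) -inner2Zl; congr (inner2 h _ b).
  by apply/funext => u; apply/funext => v; rewrite big_nil mul0r.
rewrite big_cons -IH -inner2Dl; congr (inner2 h _ b).
by apply/funext => u; apply/funext => v; rewrite big_cons.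
Qed.

Lemma inner2_wedgeC (p q : 'rV[R]_4 -> R) b :
  inner2 h (wedge p q) b = - inner2 h (wedge q p) b.
Proof.
rewrite -mulN1r -inner2Zl; congr (inner2 h _ b).
by apply/funext => u; apply/funext => v; rewrite /wedge; ring.
Qed.

Variables w1 w2 w3 : 'rV[R]_4 -> 'rV[R]_4 -> R.
Local Notation os := [:: w1; w2; w3].

Lemma inner22_sd_component T a b :
  inner22 h (sd_component h w1 w2 w3 T) a b =
  \sum_(a' <- os) \sum_(b' <- os)
     4^-1 * inner22 h T a' b' * (inner2 h a' a * inner2 h b' b).
Proof.
pose k a' b' := 4^-1 * inner22 h T a' b'.
have E u v : inner2 h (fun z w => sd_component h w1 w2 w3 T u v z w) b =
  \sum_(a' <- os) \sum_(b' <- os) (k a' b' * inner2 h b' b) * a' u v.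
  rewrite inner2_suml; apply: eq_bigr => a' _.
  rewrite inner2_suml; apply: eq_bigr => b' _.
  rewrite [RHS]mulrAC -[RHS]inner2Zl; congr (inner2 h _ b).
  by apply/funext => z; apply/funext => w; rewrite /otimes mulrA.
transitivity (inner2 h (fun u v =>
  \sum_(a' <- os) \sum_(b' <- os) (k a' b' * inner2 h b' b) * a' u v) a).
  by congr (inner2 h _ a); apply/funext => u; apply/funext => v; exact: E.
rewrite inner2_suml; apply: eq_bigr => a' _.
rewrite inner2_suml; apply: eq_bigr => b' _.
by rewrite inner2Zl -[LHS]mulrA; congr (_ * _); exact: mulrC.
Qed.

Hypotheses (w11 : inner2 h w1 w1 = 2) (w22 : inner2 h w2 w2 = 2)
  (w33 : inner2 h w3 w3 = 2) (w12 : inner2 h w1 w2 = 0)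
  (w13 : inner2 h w1 w3 = 0) (w21 : inner2 h w2 w1 = 0)
  (w23 : inner2 h w2 w3 = 0) (w31 : inner2 h w3 w1 = 0)
  (w32 : inner2 h w3 w2 = 0).

(** The symmetry of the coefficients lets each pair of off-diagonal terms be
    collected into one symmetric product. *)
Lemma sd_tracefreeE T u v z w :
  inner22 h T w2 w1 = inner22 h T w1 w2 ->
  inner22 h T w3 w2 = inner22 h T w2 w3 ->
  inner22 h T w1 w3 = inner22 h T w3 w1 ->
  sd_tracefree h w1 w2 w3 (sd_component h w1 w2 w3 T) u v z w =
  24^-1 * (2 * inner22 h T w1 w1 - inner22 h T w2 w2 - inner22 h T w3 w3)
     * (2 * otimes w1 w1 u v z w - otimes w2 w2 u v z w - otimes w3 w3 u v z w)
  + 8^-1 * (inner22 h T w2 w2 - inner22 h T w3 w3)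
     * (otimes w2 w2 u v z w - otimes w3 w3 u v z w)
  + 4^-1 * inner22 h T w1 w2 * odot w1 w2 u v z w
  + 4^-1 * inner22 h T w2 w3 * odot w2 w3 u v z w
  + 4^-1 * inner22 h T w3 w1 * odot w3 w1 u v z w.
Proof.
move=> s12 s23 s31.
rewrite /sd_tracefree /sd_trace !big_cons !big_nil !inner22_sd_component.
rewrite /sd_component /sd_identity /odot !big_cons !big_nil.
rewrite w11 w22 w33 w12 w13 w21 w23 w31 w32 s12 s23 s31.
by field.
Qed.

End InnerProduct.

(** * Dual frames *)

Section Frame.
Variables (R : realType).
Local Notation V := 'rV[R]_4.
Implicit Types (h a b : V -> V -> R).

(** The matrix of components of four independent linear forms is invertible, and
    the rows of its inverse are the dual frame. *)
Lemma exists_dual_frame (e : 'I_4 -> V -> R) :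
  (forall i, scalar (e i)) ->
  (forall l : 'I_4 -> R, (forall u, \sum_i l i * e i u = 0) ->
     forall i, l i = 0) ->
  exists f : 'I_4 -> V, forall i j, e i (f j) = (i == j)%:R.
Proof.
move=> se ie.
pose E : 'M[R]_4 := \matrix_(k, i) e i (evec R k).
have eE i (u : V) : e i u = (u *m E) 0 i.
  rewrite {1}(row_sum_delta u) scalar_sum // !mxE.
  by apply: eq_bigr => k _; rewrite !mxE.
have Eu : E^T \in unitmx.
  rewrite -row_free_unit -kermx_eq0; apply/rowV0P => v /sub_kermxP vE.
  apply/rowP => i; rewrite mxE; apply: (ie (v 0)) => u.
  transitivity ((v *m (u *m E)^T) 0 0).
    by rewrite [RHS]mxE; apply: eq_bigr => j _; rewrite eE [_^T _ _]mxE.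
  by rewrite trmx_mul mulmxA vE mul0mx mxE.
exists (fun j => row j (invmx E)) => i j.
rewrite eE -row_mul mulVmx ?mxE 1?eq_sym //.
by rewrite -unitmx_tr.
Qed.

Variables (e : 'I_4 -> V -> R) (f : 'I_4 -> V).
Hypothesis e_scalar : forall i, scalar (e i).
Hypothesis e_dual : forall i j, e i (f j) = (i == j)%:R.

Let E : 'M[R]_4 := \matrix_(k, i) e i (evec R k).
Let F : 'M[R]_4 := \matrix_(i, k) f i 0 k.

Lemma coframe_mx i (u : V) : e i u = (u *m E) 0 i.
Proof.
rewrite {1}(row_sum_delta u) scalar_sum // !mxE.
by apply: eq_bigr => k _; rewrite !mxE.
Qed.

Lemma frame_coframe_mx : F *m E = 1%:M.
Proof.
apply/matrixP => j i; rewrite [RHS]mxE eq_sym -e_dual coframe_mx !mxE.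
by apply: eq_bigr => k _; rewrite !mxE.
Qed.

Lemma frame_expand (u : V) : u = \sum_i e i u *: f i.
Proof.
rewrite -[LHS]mulmx1 -(mulmx1C frame_coframe_mx) mulmxA mulmx_sum_row.
apply: eq_bigr => i _; rewrite -coframe_mx; congr (_ *: _).
by apply/rowP => k; rewrite !mxE.
Qed.

Variable h : V -> V -> R.
Hypothesis h_frame : forall u v, h u v = \sum_i e i u * e i v.

(** With E the matrix of the coframe and F that of the dual frame, the Gram
    matrix is E E^T and F E = 1, so that the inverse is F^T F. *)
Lemma inv_gram_frame k l : inv_gram h k l = \sum_i f i 0 k * f i 0 l.
Proof.
have EF := mulmx1C frame_coframe_mx.
have HG : (\matrix_(k, l) h (evec R k) (evec R l)) = E *m E^T.
  apply/matrixP => p q; rewrite !mxE h_frame.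
  by apply: eq_bigr => i _; rewrite !mxE.
have GF : E *m E^T *m (F^T *m F) = 1%:M.
  by rewrite mulmxA -(mulmxA E) -trmx_mul frame_coframe_mx trmx1 mulmx1.
have Gu : E *m E^T \in unitmx by case: (mulmx1_unit GF).
rewrite /inv_gram HG.
have -> : invmx (E *m E^T) = F^T *m F.
  by rewrite -[LHS]mulmx1 -GF mulKmx.
by rewrite mxE; apply: eq_bigr => i _; rewrite !mxE.
Qed.

Lemma inner1_frame (a b : V -> R) : scalar a -> scalar b ->
  inner1 h a b = \sum_i a (f i) * b (f i).
Proof.
move=> sa sb.
transitivity (\sum_k \sum_l \sum_i
  (f i 0 k * a (evec R k)) * (f i 0 l * b (evec R l))).
  apply: eq_bigr => k _; apply: eq_bigr => l _.
  by rewrite inv_gram_frame mulr_suml; apply: eq_bigr => i _; rewrite mulrACA.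
under eq_bigr do rewrite exchange_big /=.
rewrite exchange_big /=; apply: eq_bigr => i _.
have expand l : scalar l -> l (f i) = \sum_k f i 0 k * l (evec R k).
  by move=> sl; rewrite {1}(row_sum_delta (f i)) scalar_sum.
rewrite (expand a) // (expand b) // mulr_suml.
by apply: eq_bigr => k _; rewrite mulr_sumr.
Qed.

Lemma inner2_frame a b : bilinear_form a -> bilinear_form b ->
  inner2 h a b = 2^-1 * \sum_i \sum_j a (f i) (f j) * b (f i) (f j).
Proof.
move=> [ar al] [br bl]; congr (_ * _).
transitivity (\sum_k \sum_l \sum_j
  inv_gram h k l * (a (evec R k) (f j) * b (evec R l) (f j))).
  apply: eq_bigr => k _; apply: eq_bigr => l _.
  rewrite -mulr_sumr -inner1_frame // mulr_sumr; apply: eq_bigr => p _.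
  by rewrite mulr_sumr; apply: eq_bigr => q _; rewrite -mulrA.
under eq_bigr do rewrite exchange_big /=.
rewrite exchange_big /= [RHS]exchange_big /=; apply: eq_bigr => j _.
exact: (inner1_frame (al (f j)) (bl (f j))).
Qed.

Lemma bilinear_wedge (p q : V -> R) :
  scalar p -> scalar q -> bilinear_form (wedge p q).
Proof.
by move=> sp sq; split=> u k v w; rewrite /wedge !sp !sq; ring.
Qed.

Lemma inner2_wedge a i j : bilinear_form a -> (forall u v, a u v = - a v u) ->
  inner2 h a (wedge (e i) (e j)) = a (f i) (f j).
Proof.
move=> ba sa; rewrite inner2_frame //; last exact: bilinear_wedge.
have delta2 (i' j' : 'I_4) (A : 'I_4 -> 'I_4 -> R) :
    \sum_k \sum_l A k l * ((i' == k)%:R * (j' == l)%:R) = A i' j'.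
  rewrite (bigD1 i') //= [X in _ + X]big1 ?addr0; last first.
    move=> k ki; rewrite big1 // => l _.
    by rewrite [i' == k]eq_sym (negPf ki) mul0r mulr0.
  rewrite (bigD1 j') //= big1 ?addr0 ?eqxx ?mulr1 // => l lj.
  by rewrite [j' == l]eq_sym (negPf lj) !mulr0.
transitivity (2^-1 * (a (f i) (f j) - a (f j) (f i))); last first.
  by rewrite (sa (f j)); field.
congr (_ * _).
under eq_bigr do under eq_bigr do rewrite /wedge !e_dual mulrBr.
under eq_bigr do rewrite sumrB.
rewrite sumrB; congr (_ - _).
  exact: delta2.
under eq_bigr do under eq_bigr do rewrite [(i == _)%:R * _]mulrC.
exact: delta2.
Qed.

(** J maps f_i to the sum of the o(f_i, f_j) f_j, so that both sides are the
    contraction of o with b' (x) b. *)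
Lemma inner1_complex (J : V -> V) o (b b' : V -> R) :
  bilinear_form o -> (forall u v, o u v = - o v u) ->
  (forall u v, o u v = h (J u) v) -> scalar b -> scalar b' ->
  inner1 h (b \o J) b' = inner2 h (wedge b' b) o.
Proof.
move=> bo so oJ sb sb'; have [_ ol] := bo.
have hf u j : h u (f j) = e j u.
  rewrite h_frame (bigD1 j) //= e_dual eqxx mulr1 big1 ?addr0 // => i ij.
  by rewrite e_dual (negPf ij) mulr0.
have JE u : J u = \sum_j o u (f j) *: f j.
  by rewrite {1}(frame_expand (J u)); apply: eq_bigr => j _; rewrite oJ hf.
have bJ u : b (J u) = \sum_j o u (f j) * b (f j) by rewrite JE scalar_sum.
have sJ : scalar (b \o J).
  move=> k u v /=; rewrite !bJ mulr_sumr -big_split /=.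
  by apply: eq_bigr => j _; rewrite ol mulrDl mulrA.
rewrite inner1_frame // inner2_frame //; last exact: bilinear_wedge.
transitivity (\sum_i \sum_j o (f i) (f j) * b (f j) * b' (f i)).
  by apply: eq_bigr => i _; rewrite /= bJ mulr_suml.
have E1 : \sum_i \sum_j wedge b' b (f i) (f j) * o (f i) (f j) =
   \sum_i \sum_j o (f i) (f j) * b (f j) * b' (f i)
   + \sum_i \sum_j o (f i) (f j) * b (f j) * b' (f i).
  rewrite [X in _ = _ + X]exchange_big -big_split /=; apply: eq_bigr => i _.
  rewrite -big_split /=; apply: eq_bigr => j _.
  rewrite /wedge (so (f j) (f i)); ring.
by rewrite E1; field.
Qed.


End Frame.

(** * The self-dual forms of an orthonormal coframe *)

Section SelfDualBasis.
Variable R : realType.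
Local Notation V := 'rV[R]_4.
Local Notation i0 := (@Ordinal 4 0 isT).
Local Notation i1 := (@Ordinal 4 1 isT).
Local Notation i2 := (@Ordinal 4 2 isT).
Local Notation i3 := (@Ordinal 4 3 isT).
Variables (e : 'I_4 -> V -> R) (f : 'I_4 -> V).
Hypothesis e_scalar : forall i, scalar (e i).
Hypothesis e_dual : forall i j, e i (f j) = (i == j)%:R.
Variable h : V -> V -> R.
Hypothesis h_frame : forall u v, h u v = \sum_i e i u * e i v.

(** For an even permutation (i, j, k, l) of the indices, this is self-dual with
    respect to the orientation that makes (e_0, e_1, e_2, e_3) positive. *)
Definition self_dual (i j k l : 'I_4) : V -> V -> R :=
  fun u v => wedge (e i) (e j) u v + wedge (e k) (e l) u v.

Local Notation w1 := (self_dual i0 i1 i2 i3).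
Local Notation w2 := (self_dual i0 i2 i3 i1).
Local Notation w3 := (self_dual i0 i3 i1 i2).

Lemma self_dual_form i j k l : bilinear_form (self_dual i j k l) /\
  forall u v, self_dual i j k l u v = - self_dual i j k l v u.
Proof.
rewrite /self_dual /wedge; split; last by move=> u v; ring.
by split=> u b v w; rewrite !e_scalar; ring.
Qed.

Lemma inner2_self_dual a i j k l :
  bilinear_form a -> (forall u v, a u v = - a v u) ->
  inner2 h a (self_dual i j k l) = a (f i) (f j) + a (f k) (f l).
Proof. by move=> ba sa; rewrite inner2Dr !(inner2_wedge e_scalar e_dual h_frame). Qed.

(** Pairing with a self-dual form is evaluation on two pairs of frame vectors,
    so that the symmetry of T under exchange of pairs applies directly. *)
Lemma inner22_self_dual_sym T i j k l i' j' k' l' :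
  (forall u v, bilinear_form (T u v)) ->
  (forall u v z w, T u v z w = - T u v w z) ->
  (forall u v z w, T u v z w = T z w u v) ->
  inner22 h T (self_dual i j k l) (self_dual i' j' k' l') =
  inner22 h T (self_dual i' j' k' l') (self_dual i j k l).
Proof.
move=> bT sT pT.
have E m n p q : (fun u v => inner2 h (T u v) (self_dual m n p q)) =
  (fun u v => T (f m) (f n) u v + T (f p) (f q) u v).
  apply/funext => u; apply/funext => v.
  by rewrite inner2_self_dual // (pT u v) [T u v _ _]pT.
rewrite /inner22 !E !inner2Dl !inner2_self_dual //.
rewrite (pT (f i') (f j') (f i)) (pT (f i') (f j') (f k)).
rewrite (pT (f k') (f l') (f i)) (pT (f k') (f l') (f k)).
ring.
Qed.

Lemma self_dual_orthonormal :
  [/\ inner2 h w1 w1 = 2, inner2 h w2 w2 = 2 & inner2 h w3 w3 = 2] /\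
  [/\ inner2 h w1 w2 = 0, inner2 h w1 w3 = 0 & inner2 h w2 w1 = 0] /\
  [/\ inner2 h w2 w3 = 0, inner2 h w3 w1 = 0 & inner2 h w3 w2 = 0].
Proof.
have S i j k l := self_dual_form i j k l.
do ![split]; rewrite inner2_self_dual;
  try exact: (S _ _ _ _).1; try exact: (S _ _ _ _).2.
all: rewrite /self_dual /wedge !e_dual /=; ring.
Qed.

Variable r : V -> V.
Hypothesis r_skew : forall z w, h (r w) z = - h (r z) w.
Hypothesis h_bilinear : bilinear_form h.

Let rho z w := h (r w) z.

Lemma coframe_endoE i j : e i (r (f j)) = rho (f i) (f j).
Proof.
rewrite /rho h_frame (bigD1 i) //= e_dual eqxx mulr1 big1 ?addr0 // => k ki.
by rewrite e_dual (negPf ki) mulr0.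
Qed.

Lemma skew_endo_form : bilinear_form rho.
Proof.
have rl u : scalar (rho u).
  move=> k v w; rewrite /rho !(r_skew u) (h_bilinear.1 (r u)); ring.
split=> // v; exact: h_bilinear.1.
Qed.

(** The action of r on w2 lies in the plane of w3 and w1, and its coefficient on
    w3 is recovered by evaluating at the pair (f0, f3), where w3 is 1 and w1
    vanishes. *)
Lemma rotation_component1 A B :
  (forall p q, - w2 (r p) q - w2 p (r q) = A * w3 p q - B * w1 p q) ->
  inner2 h rho w1 = - A.
Proof.
move=> H; rewrite inner2_self_dual //; last exact: skew_endo_form.
have := H (f i0) (f i3); rewrite /self_dual /wedge !coframe_endoE !e_dual /=.
have : rho (f i0) (f i1) = - rho (f i1) (f i0) by exact: r_skew.
lra.
Qed.

(** As above, the two coefficients being recovered at the pairs (f0, f2) and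
    (f0, f3). *)
Lemma rotation_component23 A B :
  (forall p q, - w1 (r p) q - w1 p (r q) = A * w2 p q - B * w3 p q) ->
  inner2 h rho w3 = - A /\ inner2 h rho w2 = - B.
Proof.
move=> H; rewrite !inner2_self_dual //; try exact: skew_endo_form.
have := H (f i0) (f i2); have := H (f i0) (f i3).
rewrite /self_dual /wedge !coframe_endoE !e_dual /=.
have : rho (f i0) (f i3) = - rho (f i3) (f i0) by exact: r_skew.
have : rho (f i0) (f i2) = - rho (f i2) (f i0) by exact: r_skew.
have : rho (f i1) (f i3) = - rho (f i3) (f i1) by exact: r_skew.
split; lra.
Qed.

End SelfDualBasis.

(** * Adapted coframes in a chart *)

Section AdaptedCoframes.
Variables (R : realType) (M : smooth_manifold R 4).
Local Notation V := 'rV[R]_4.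
Local Notation i0 := (@Ordinal 4 0 isT).
Local Notation i1 := (@Ordinal 4 1 isT).
Local Notation i2 := (@Ordinal 4 2 isT).
Local Notation i3 := (@Ordinal 4 3 isT).

Lemma img_subset (U : set M) (c : chart M) : img U c `<=` img setT c.
Proof. by move=> _ [p [cp _] <-]; exists p. Qed.

Lemma open_img (U : set M) (c : chart M) : open U -> open (img U c).
Proof.
move=> oU.
have -> : img U c = (Defs.coord c @` dom c) `&` coordV c @^-1` U.
  apply/seteqP; split=> [_ [p [cp Up] <-]|x [[p cp <-]]].
    by split; [exists p|rewrite /= coordK].
  by rewrite /= coordK // => Up; exists p.
rewrite openE => x [Ix Ux]; apply: filterI.
  by apply: open_nbhs_nbhs; split=> //; exact: img_open.
by apply: coordV_continuous => //; exact: open_nbhs_nbhs.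
Qed.

Lemma sum4 (F : 'I_4 -> R) : \sum_i F i = F i0 + F i1 + F i2 + F i3.
Proof.
rewrite !big_ord_recl big_ord0 addr0 !addrA.
by congr (F _ + F _ + F _ + F _); exact: val_inj.
Qed.

Lemma indexed_coframe (o1 o2 o3 g : field2 M) (U : set M)
    (e1 e2 e3 e4 : field1 M) :
  open U -> adapted_coframe o1 o2 o3 U e1 e2 e3 e4 ->
  induced_metric o1 o2 o3 g ->
  exists e : 'I_4 -> field1 M, (forall i, is_form1 U (e i)) /\
    forall c x, img U c x ->
    [/\ forall l : 'I_4 -> R, (forall u, \sum_i l i * e i c x u = 0) ->
          forall i, l i = 0,
        forall u v, g c x u v = \sum_i e i c x u * e i c x v,
        o1 c x = self_dual (fun i => e i c x) i0 i1 i2 i3,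
        o2 c x = self_dual (fun i => e i c x) i0 i2 i3 i1 &
        o3 c x = self_dual (fun i => e i c x) i0 i3 i1 i2].
Proof.
move=> oU adapted gP; have [[f1 f2 f3 f4 indep] oE] := adapted.
exists (fun i => nth e1 [:: e1; e2; e3; e4] i); split.
  by case=> [[|[|[|[|//]]]] ?].
move=> c x Ux; have gx := gP U e1 e2 e3 e4 oU adapted c x Ux.
split=> [l l0|u v| | |].
- have [|z0 z1 z2 z3] := indep c x Ux (l i0) (l i1) (l i2) (l i3).
    by move=> u; rewrite -(l0 u) sum4.
  case=> [[|[|[|[|//]]]] ?]; [rewrite -z0|rewrite -z1|rewrite -z2|rewrite -z3];
    by congr (l _); exact: val_inj.
- by rewrite gx sum4.
- by apply/funext => u; apply/funext => v; have [-> _ _] := oE c x Ux u v.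
- by apply/funext => u; apply/funext => v; have [_ -> _] := oE c x Ux u v.
- by apply/funext => u; apply/funext => v; have [_ _ ->] := oE c x Ux u v.
Qed.

(** The metric is not given as a smooth tensor field: it is one because the
    coframes are smooth. *)
Lemma metric_smooth (U : set M) (e : 'I_4 -> field1 M) (g : field2 M)
    (c : chart M) :
  open U -> (forall i, is_form1 U (e i)) ->
  (forall x, img U c x ->
     forall u v, g c x u v = \sum_i e i c x u * e i c x v) ->
  (forall x, img U c x -> bilinear_form (g c x)) /\
  (forall u v, smooth_on (img U c) (fun x => g c x u v : R^o)).
Proof.
move=> oU eP gE; split=> [x Ux|u v].
  have se i : scalar (e i c x) by have [+ _ _] := eP i; apply.
  split=> u k v w; rewrite !gE // mulr_sumr -big_split /=; apply: eq_bigr => i _;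
    rewrite se; ring.
have sm i w : smooth_on (img U c) (fun x => e i c x w : R^o).
  by have [_ + _] := eP i; apply.
have oO := open_img (c := c) oU.
pose q i : V -> R^o :=
  (fun x => e i c x u : R^o) * (fun x => e i c x v : R^o).
have sq : smooth_on (img U c) (q i0 + q i1 + q i2 + q i3).
  by do ![apply: smoothD => //]; apply: smoothM.
move=> k; apply: (Ck_on_ext oO _ (sq k)) => x Ux.
by rewrite gE // sum4.
Qed.

End AdaptedCoframes.

(** * The self-dual Weyl curvature *)

Unset Implicit Arguments.

Theorem proposition4p7 (R : realType) (M : smooth_manifold R 4)
    (M_oriented : oriented_atlas M) (M_connected : connected [set: M])
    (o1 o2 o3 : field2 M) (su2 : SU2_structure o1 o2 o3)
    (g : field2 M) (g_induced : induced_metric o1 o2 o3 g)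
    (J1 J2 J3 : endo_field M) (J1P : almost_complex_of g o1 J1)
    (J2P : almost_complex_of g o2 J2) (J3P : almost_complex_of g o3 J3)
    (nabla : christoffel M) (nablaP : levi_civita g nabla)
    (a1 a2 a3 : field1 M) (aP : torsion_forms o1 o2 o3 nabla a1 a2 a3) :
  forall (c : chart M) (x : 'rV[R]_4), img setT c x ->
  let w1 := o1 c x in let w2 := o2 c x in let w3 := o3 c x in
  let j1 := J1 c x in let j2 := J2 c x in let j3 := J3 c x in
  let b1 := a1 c x in let b2 := a2 c x in let b3 := a3 c x in
  let da1 := ext_d a1 c x in let da2 := ext_d a2 c x in
  let da3 := ext_d a3 c x in
  let g1 := inner1 (g c x) in let g2 := inner2 (g c x) in
  forall u v z w : 'rV[R]_4,
  weyl_plus o1 o2 o3 g nabla c x u v z w =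
    - 24^-1 * (2 * g2 da1 w1 - g2 da2 w2 - g2 da3 w3
               + g1 (b1 \o j3) b2 - g1 (b1 \o j2) b3 - 2 * g1 (b2 \o j1) b3)
      * (2 * otimes w1 w1 u v z w - otimes w2 w2 u v z w - otimes w3 w3 u v z w)
    - 8^-1 * (g2 da2 w2 - g2 da3 w3 + g1 (b1 \o j3) b2 + g1 (b1 \o j2) b3)
      * (otimes w2 w2 u v z w - otimes w3 w3 u v z w)
    - 4^-1 * (g2 da2 w1 + g1 (b1 \o j1) b3) * odot w1 w2 u v z w
    - 4^-1 * (g2 da3 w2 + g1 (b2 \o j2) b1) * odot w2 w3 u v z w
    - 4^-1 * (g2 da1 w3 + g1 (b3 \o j3) b2) * odot w3 w1 u v z w.
Proof.
move=> c x cx.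
pose V := 'rV[R]_4.
have [p [cp _] xE] := cx.
have [F1 F2 F3 adapted] := su2.
have [U [oU Up [e1 [e2 [e3 [e4 eP]]]]]] := adapted p.
have [e [eF eO]] := indexed_coframe oU eP g_induced.
have Ox : img U c x by rewrite -xE; exists p.
have oO := open_img (c := c) oU.
have imgT : img U c `<=` img setT c := @img_subset _ _ U c.
have [g_bil g_sm] := metric_smooth (c := c) oU eF
  (fun y Uy => let: And5 _ gE _ _ _ := eO c y Uy in gE).
have [ind gE E1 E2 E3] := eO c x Ox.
have se i : scalar (e i c x) by have [+ _ _] := eF i; apply.
have [f ef] := exists_dual_frame se ind.
have [GC Gsym Gpar] := nablaP.
have [a1F a2F a3F torsion] := aP.
have form2_bil (o : field2 M) : is_form2 setT o ->
    forall y, img U c y -> bilinear_form (o c y).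
  by move=> [+ _ _ _] y Uy => /(_ c y (imgT y Uy)).
have form2_sm (o : field2 M) : is_form2 setT o ->
    forall u v, smooth_on (img U c) (fun y => o c y u v : R^o).
  by move=> [_ _ + _] u v => /(_ c u v); exact: smooth_on_sub.
have form1_sm (a : field1 M) : is_form1 setT a ->
    forall u, smooth_on (img U c) (fun y => a c y u : R^o).
  by move=> [_ + _] u => /(_ c u); exact: smooth_on_sub.
have form1_sc (a : field1 M) : is_form1 setT a -> scalar (a c x).
  by move=> [+ _ _]; apply.
have G_sm u v : smooth_on (img U c) (fun y => nabla c y u v).
  by have [_ + _] := GC => /(_ c u v); exact: smooth_on_sub.
have g_sym u v : g c x u v = g c x v u.
  by rewrite !gE; apply: eq_bigr => i _; exact: mulrC.
have g_par y X u v : img U c y -> cov_deriv2 nabla g c y X u v = 0.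
  by move=> Uy; apply: Gpar; exact: imgT.
have [gr gl] := g_bil x Ox.
pose T := riemann g nabla c x.
have T34 u v z w : T u v z w = - T u v w z by exact: (riemann_skew oO Ox).
have T12 u v z w : T u v z w = - T v u z w.
  rewrite /T /riemann (curvature_skew _ _ _ v u).
  by rewrite (@scalarN _ _ (g c x ^~ z)) ?opprK.
have T_bianchi u v z w : T u v z w + T v w z u + T w u z v = 0.
  rewrite /T /riemann -!(@scalarD _ _ (g c x ^~ z)) //.
  rewrite (curvature_bianchi oO Ox) ?(scalar_zero (gl z)) // => y Uy a b.
  by apply: Gsym; exact: imgT.
have T_pair := pair_symmetry T12 T34 T_bianchi.
have T_bil u v : bilinear_form (T u v).
  apply: (@skew_endo_form _ (g c x) (curvature nabla c x u v)); last by split.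
  by move=> z w; exact: T34.
have tor y X a b (Uy : img U c y) := torsion c y (imgT y Uy) X a b.
(* The curvature forms of the connection on self-dual forms. *)
pose K1 u v := ext_d a1 c x u v + wedge (a2 c x) (a3 c x) u v.
pose K2 u v := ext_d a2 c x u v + wedge (a3 c x) (a1 c x) u v.
pose K3 u v := ext_d a3 c x u v + wedge (a1 c x) (a2 c x) u v.
have [T3 T2] : (forall u v, inner2 (g c x) (T u v) (o3 c x) = - K3 u v) /\
               (forall u v, inner2 (g c x) (T u v) (o2 c x) = - K2 u v).
  apply/all_and2 => u; apply/all_and2 => v; rewrite E2 E3.
  apply: (rotation_component23 se ef gE (r := curvature nabla c x u v)).
  - by move=> z w; exact: T34.
  - by split.
  move=> a b; rewrite -E1 -E2 -E3.
  apply: (curvature_rotation oO Ox (form2_bil _ F1) (form2_sm _ F1)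
    (form2_sm _ F2) (form2_sm _ F3) (form1_sm _ a2F) (form1_sm _ a3F) G_sm).
  by move=> y X s t Uy; exact: tor.
(* The same row of the curvature, for the cyclic permutation (o2, o3, o1). *)
have T1 u v : inner2 (g c x) (T u v) (o1 c x) = - K1 u v.
  rewrite E1.
  apply: (rotation_component1 se ef gE (r := curvature nabla c x u v)).
  - by move=> z w; exact: T34.
  - by split.
  move=> a b; rewrite -E1 -E2 -E3.
  apply: (curvature_rotation oO Ox (form2_bil _ F2) (form2_sm _ F2)
    (form2_sm _ F3) (form2_sm _ F1) (form1_sm _ a3F) (form1_sm _ a1F) G_sm).
  by move=> y X s t Uy; have [C1 C2 C3] := tor y X s t Uy; split.
have pairing (a w : V -> V -> R) da b b' :
    (forall u v, inner2 (g c x) (T u v) w = - (da u v + wedge b b' u v)) ->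
    inner22 (g c x) T a w =
    - (inner2 (g c x) da a + inner2 (g c x) (wedge b b') a).
  move=> Tw; rewrite -inner2Dl -mulN1r -inner2Zl /inner22; congr (inner2 _ _ a).
  by apply/funext => u; apply/funext => v; rewrite Tw mulN1r.
have J_inner (o : field2 M) J b b' : bilinear_form (o c x) ->
    (forall u v, o c x u v = - o c x v u) -> almost_complex_of g o J ->
    scalar b -> scalar b' ->
    inner1 (g c x) (b \o J c x) b' = inner2 (g c x) (wedge b' b) (o c x).
  move=> bo so oJ sb sb'.
  by apply: (inner1_complex se ef gE bo so) => // u v; exact: oJ.
have [b1 b2 b3] : [/\ scalar (a1 c x), scalar (a2 c x) & scalar (a3 c x)].
  by split; exact: form1_sc.
have [S1 A1] : bilinear_form (o1 c x) /\ forall u v, o1 c x u v = - o1 c x v u.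
  by rewrite E1; exact: self_dual_form.
have [S2 A2] : bilinear_form (o2 c x) /\ forall u v, o2 c x u v = - o2 c x v u.
  by rewrite E2; exact: self_dual_form.
have [S3 A3] : bilinear_form (o3 c x) /\ forall u v, o3 c x u v = - o3 c x v u.
  by rewrite E3; exact: self_dual_form.
have [[n11 n22 n33] [[n12 n13 n21] [n23 n31 n32]]] :=
  self_dual_orthonormal se ef gE.
rewrite -E1 -E2 -E3 in n11 n22 n33 n12 n13 n21 n23 n31 n32.
move=> w1 w2 w3 j1 j2 j3 c1 c2 c3 da1 da2 da3 g1 g2 u v z w.
rewrite /weyl_plus sd_tracefreeE //.
- rewrite !(pairing _ _ _ _ _ T1) !(pairing _ _ _ _ _ T2) !(pairing _ _ _ _ _ T3).
  rewrite /g1 (J_inner o3 J3 _ _ S3 A3 J3P b1 b2) (J_inner o2 J2 _ _ S2 A2 J2P b1 b3).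
  rewrite (J_inner o1 J1 _ _ S1 A1 J1P b2 b3) (J_inner o1 J1 _ _ S1 A1 J1P b1 b3).
  rewrite (J_inner o2 J2 _ _ S2 A2 J2P b2 b1) (J_inner o3 J3 _ _ S3 A3 J3P b3 b2).
  (* Both sides are now expressed by the wedges of K1, K2 and K3. *)
  rewrite (inner2_wedgeC _ (a2 c x) (a1 c x)) (inner2_wedgeC _ (a3 c x) (a2 c x)).
  rewrite -/w1 -/w2 -/w3 -/g2 -/da1 -/da2 -/da3.
  by field.
- by rewrite E1 E2; apply: (inner22_self_dual_sym se ef gE).
- by rewrite E2 E3; apply: (inner22_self_dual_sym se ef gE).
- by rewrite E1 E3; apply: (inner22_self_dual_sym se ef gE).
Qed.
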